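(* For every $\gamma,\beta$ with $0<\gamma\le\beta<2$ there exists a bounded positive function $H$ on $\mathbb{D}$ such that $R(L_\gamma(H))\ne R_\beta(H)$.
   Context: $\mathbb{D}$ is the open unit disk in $\mathbb{C}$. Pseudohyperbolic distance: $d(z,w)=\left|\frac{z-w}{1-z\overline{w}}\right|$; hyperbolic distance: $\rho(z,w)=\frac12\log\frac{1+d(z,w)}{1-d(z,w)}$. A positive-valued function $F$ on $\mathbb{D}$ is Log-Lipschitz with constant $C$ if $|\log F(z)-\log F(w)|\le C\rho(z,w)$ for all $z,w\in\mathbb{D}$. $Sp(\mathbb{D})$ is the cone of superharmonic functions on $\mathbb{D}$ (not identically $+\infty$). For a function $\varphi:\mathbb{D}\to[0,\infty)$: - the reduced function is $R(\varphi)(z)=\inf\{u(z): u\in Sp(\mathbb{D}),\ u\ge\varphi \text{ on }\mathbb{D}\}$, with $R(\varphi)\equiv\infty$ if no such $u$ exists; - $R_C(\varphi)(z)=\inf\{u(z): u\in Sp(\mathbb{D}),\ u \text{ positive and Log-Lipschitz with constant } C,\ u\ge\varphi\text{ on }\mathbb{D}\}$ (with value $\infty$ if no such $u$ exists); - $L_C(\varphi)(z)=\sup_{w\in\mathbb{D}}\varphi(w)e^{-C\rho(w,z)}$, the smallest Log-Lipschitz majorant of $\varphi$ with constant $C$. *)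

(* Defs.v *)
From mathcomp Require Import all_boot all_order all_algebra.
From mathcomp Require Import all_classical all_reals all_analysis.
From mathcomp Require Import complex.

Set Implicit Arguments.
Unset Strict Implicit.
Unset Printing Implicit Defensive.

Import Order.TTheory GRing.Theory Num.Theory.
Import numFieldNormedType.Exports ComplexField.Normc.

Local Open Scope classical_set_scope.
Local Open Scope ring_scope.

Section potential_theory.
Context {R : realType}.
Implicit Types (z w : R[i]) (C : R).

Definition unit_disk : set R[i] := [set z | normc z < 1].

Definition pseudohyperbolic z w : R := normc ((z - w) / (1 - z * w^*%C)).

Definition hyperbolic z w : R :=
  2^-1 * ln ((1 + pseudohyperbolic z w) / (1 - pseudohyperbolic z w)).

Definition log_lipschitz C (F : R[i] -> R) :=
  (forall z, unit_disk z -> 0 < F z) /\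
  (forall z w, unit_disk z -> unit_disk w ->
    `|ln (F z) - ln (F w)| <= C * hyperbolic z w).

Definition circle_mean (u : R[i] -> \bar R) (a : R[i]) (r : R) : \bar R :=
  (((2 * pi)^-1)%R%:E *
   \int[lebesgue_measure]_(t in `[0%R, (2 * pi)%R])
     u (a + r%:C%C * (cos t +i* sin t)%C)%R)%E.

(* Functions on the disk are functions on [R[i]] whose values outside the disk
   are never looked at; [subspace] makes semicontinuity relative to the disk.
   The topology of the plane is found on [R[i]^o], not on [R[i]] itself. *)
Record superharmonic (u : R[i] -> \bar R) : Prop := Superharmonic {
  superharmonic_gtNy : forall z, unit_disk z -> (-oo < u z)%E ;
  superharmonic_lsc :
    lower_semicontinuous (u : subspace (unit_disk : set R[i]^o) -> \bar R) ;
  superharmonic_mean : forall (a : R[i]) (r : R), 0 < r ->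
    [set z | normc (z - a) <= r] `<=` unit_disk ->
    (circle_mean u a r <= u a)%E ;
  superharmonic_finite : exists2 z, unit_disk z & (u z < +oo)%E }.

Definition reduced (phi : R[i] -> \bar R) z : \bar R :=
  ereal_inf [set u z | u in [set u : R[i] -> \bar R |
    superharmonic u /\ forall w, unit_disk w -> (phi w <= u w)%E]].

Definition log_lipschitz_reduced C (phi : R[i] -> R) z : \bar R :=
  ereal_inf [set (u z)%:E | u in [set u : R[i] -> R |
    [/\ superharmonic (EFin \o u), log_lipschitz C u &
        forall w, unit_disk w -> phi w <= u w]]].

Definition log_lipschitz_majorant C (phi : R[i] -> R) z : \bar R :=
  ereal_sup [set (phi w * expR (- (C * hyperbolic w z)))%:E
            | w in unit_disk].

End potential_theory.

Arguments unit_disk R : clear implicits.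

(* Main.v *)
Require Import Defs.
From mathcomp Require Import all_boot all_order all_algebra.
From mathcomp Require Import all_classical all_reals all_analysis.
From mathcomp Require Import complex ring lra.
Import Order.TTheory GRing.Theory Num.Theory.
Import numFieldNormedType.Exports ComplexField.Normc.
Local Open Scope classical_set_scope.
Local Open Scope ring_scope.

Set Implicit Arguments.
Unset Strict Implicit.
Unset Printing Implicit Defensive.

(* Map the disk to the upper half plane by [i (1 + z) / (1 - z)], and let [x(z)]
   in [(0, pi / 2)] be half the argument of the image. Then [x] is harmonic, and
   [ln (tan x)] is Lipschitz with constant 2 for [rho], with equality along the
   imaginary axis. Put [q = beta / 2], so that [0 < q < 1].

   If [gamma < beta], take [H = x^q]: it is superharmonic, being a concave function
   of [x], and log-Lipschitz with constant [beta], so [R_beta H = H]. But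
   [x ~ tan x] as [x -> 0], so on the imaginary axis near [-i] it decays too fast
   for the constant [gamma], whence [H < L_gamma H <= R (L_gamma H)] there.

   If [gamma = beta], take [H = min (tan x, 2)^q], so that [L_beta H = H]. As
   [H <= x^q + 20 x] and the latter is superharmonic, [R H / (tan x)^q] tends to
   [1] along the imaginary axis at [-i]. If [R_beta H = R H], the log-Lipschitz
   bound between [0] and points tending to [-i] gives [R H (0) <= 1]. But near [0],
   [H = (tan x)^q] has mean greater than [1 = H 0] on a circle centered at [0], so
   [R H (0) > 1]. *)

(** * Integrals of continuous functions *)

Section real_analysis.
Context {R : realType}.
Implicit Types (a b c t u v r : R).
Local Notation mu := (@lebesgue_measure R).

(** For [t] at or past [pi / 2], the angle [t - pi / 2] lies where the sine is nonnegative, and its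
    sine is [- cos t]. This serves to check that a sum of two arctangents is again in the range of
    [atan]. *)
Lemma cos_gt0_itv t : - pi < t < pi -> 0 < cos t -> - (pi / 2) < t < pi / 2.
Proof.
move=> /andP[t1 t2] ct; apply/andP; split; rewrite ltNge; apply/negP => h.
  have := @sin_ge0_pi R (- t - pi / 2); rewrite sinB sinN cosN cos_pihalf sin_pihalf.
  have := pi_gt0 R; lra.
have := @sin_ge0_pi R (t - pi / 2); rewrite sinB cos_pihalf sin_pihalf.
have := pi_gt0 R; lra.
Qed.

Lemma atan_tan t : - (pi / 2) < t < pi / 2 -> atan (tan t) = t.
Proof. by move=> h; apply: tanK; rewrite in_itv. Qed.

Lemma continuous_integrable (g : R -> R) a b :
  continuous g -> mu.-integrable `[a, b] (EFin \o g).
Proof.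
move=> cg; apply: continuous_compact_integrable; first exact: segment_compact.
exact: continuous_subspaceT.
Qed.

Lemma Rintegral_split (g : R -> R) a b c : continuous g -> a <= c -> c <= b ->
  (\int[mu]_(t in `[a, b]) g t =
   \int[mu]_(t in `[a, c]) g t + \int[mu]_(t in `[c, b]) g t)%R.
Proof.
move=> cg ac cb.
have := @Rintegral_itvB R g (BLeft a) (BRight b) c (continuous_integrable a b cg).
rewrite !bnd_simp => /(_ ac cb).
rewrite Rintegral_itv_obnd_cbnd; last first.
  apply: (@integrableS _ _ _ mu `[c, b]%classic) => //.
  - by apply: subset_itvr; rewrite bnd_simp.
  - exact: continuous_integrable.
by move=> <-; rewrite addrC subrK.
Qed.

(** The substitution [t -> a + b - t] preserves the segment and shows that the integral equals its
    own opposite. *)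
Lemma Rintegral_antisym (g : R -> R) a b : a <= b -> continuous g ->
  (forall t, g (a + b - t) = - g t) -> (\int[mu]_(t in `[a, b]) g t = 0)%R.
Proof.
move=> ab cg gN.
pose F t : R := a + b - t.
have dF t : is_derive t (1:R) F (-1).
  by rewrite /F; apply: is_derive_eq; rewrite add0r mul1r.
have cF : continuous F by move=> t; apply: cvgB; [exact: cvg_cst|exact: cvg_id].
have F' : derive1 F = cst (-1).
  by apply/funext => t; rewrite derive1E; apply: derive_val.
have := @integration_by_substitution_decreasing R F g a b ab.
rewrite F' /F; have -> : a + b - b = a by lra.
have -> : a + b - a = b by lra.
move=> H.
suff : (\int[mu]_(t in `[a, b]) g t = - \int[mu]_(t in `[a, b]) g t)%R by lra.
rewrite {1}/Rintegral H.
- rewrite -[in RHS]mulN1r -RintegralZl//; last exact: continuous_integrable.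
  congr fine; apply: eq_integral => t _ /=.
  by rewrite /= !fctE /= gN; congr EFin; ring.
- by move=> x y _ _ xy; lra.
- by move=> x _; exact: cst_continuous.
- exact: is_cvg_cst.
- exact: is_cvg_cst.
- split.
  + by move=> x _.
  + by apply: cvg_at_right_filter; exact: cF.
  + by apply: cvg_at_left_filter; exact: cF.
- exact: continuous_subspaceT.
Qed.

Lemma Rintegral_segment_cst a b c : a <= b ->
  (\int[mu]_(t in `[a, b]) c = c * (b - a))%R.
Proof.
move=> ab; rewrite Rintegral_cst//; congr (_ * _).
have /= -> := lebesgue_measure_itv `[a, b]%R; rewrite lte_fin.
by have [] := ltP a b => //= ba; apply/eqP; rewrite eq_sym subr_eq0 eq_le ab ba.
Qed.
End real_analysis.

(** * The mean of the argument over a circle *)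

Section circle_argument.
Context {R : realType}.
Implicit Types (a b c t u v r s al : R).
Local Notation mu := (@lebesgue_measure R).

Lemma normr_mul_cos_le r t : `|r * cos t| <= `|r|.
Proof. by rewrite normrM ler_piMr// cos_max. Qed.

(* With polar coordinates [s, al] for [u + i v], the argument of
   [u + i v + r e^(it)] is [al] plus a function of [t] which is odd about [al]
   and about [al + pi]. *)
Lemma atan_add_polar s r al t : - (pi / 2) < al < pi / 2 -> 0 < s ->
  `|r| < s * cos al ->
  atan ((s * sin al + r * sin t) / (s * cos al + r * cos t)) =
  al + atan (r * sin (t - al) / (s + r * cos (t - al))).
Proof.
move=> alb s0 rs.
have ca : 0 < cos al by exact: cos_gt0_pihalf.
have D1 : 0 < s * cos al + r * cos t.
  have := normr_mul_cos_le r t; rewrite ler_norml => /andP[? _]; lra.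
set p := t - al.
have tE : t = al + p by rewrite /p; lra.
move: p tE => p tE.
have sc : s * cos al <= s by rewrite ler_piMr ?cos_le1// ltW.
have D2 : 0 < s + r * cos p.
  have := normr_mul_cos_le r p; rewrite ler_norml => /andP[? _]; lra.
set d := atan (r * sin p / _).
have db : - (pi / 2) < d < pi / 2 by rewrite atan_gtNpi2 atan_ltpi2.
have cd : 0 < cos d by exact: cos_gt0_pihalf.
have sd : sin d = cos d * (r * sin p / (s + r * cos p)).
  have <- : tan d = r * sin p / (s + r * cos p) by exact: atanK.
  by rewrite mulrC divfK// gt_eqF.
(* The point is [e^(i al) (s + r e^(ip))], and [cos d / (s + r * cos p)] is the inverse of its
   modulus. So [al + d] has the right cosine and sine, and the sign of the cosine then places it in
   the range of [atan]. *)
have cE : cos (al + d) = cos d / (s + r * cos p) * (s * cos al + r * cos t).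
  by rewrite tE !cosD sd; field; rewrite gt_eqF.
have sE : sin (al + d) = cos d / (s + r * cos p) * (s * sin al + r * sin t).
  by rewrite tE !sinD sd; field; rewrite gt_eqF.
have k0 : 0 < cos d / (s + r * cos p) by rewrite divr_gt0.
rewrite -[RHS]atan_tan; first by rewrite /tan cE sE -mulf_div divff ?gt_eqF// mul1r.
apply: cos_gt0_itv; last by rewrite cE mulr_gt0.
by move: alb db => /andP[? ?] /andP[? ?]; apply/andP; split; lra.
Qed.

(** Mean value property of the argument, harmonic in the right half plane; [|r| < u] keeps the
    circle there. The oscillating part [h] integrates to zero by its symmetries. *)
Lemma Rintegral_atan_circle u v r : 0 < u -> `|r| < u ->
  (\int[mu]_(t in `[0, 2 * pi]) atan ((v + r * sin t) / (u + r * cos t)) =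
   2 * pi * atan (v / u))%R.
Proof.
move=> u0 ru; have pi0 := pi_gt0 R.
set al := atan (v / u).
have alb : - (pi / 2) < al < pi / 2 by rewrite atan_gtNpi2 atan_ltpi2.
have ca : 0 < cos al by exact: cos_gt0_pihalf.
pose s := u / cos al.
have s0 : 0 < s by rewrite divr_gt0.
have uE : u = s * cos al by rewrite /s divfK// gt_eqF.
have vE : v = s * sin al.
  have /eqP := atanK (v / u).
  rewrite -/al /tan (eqr_div _ _ (lt0r_neq0 ca) (lt0r_neq0 u0)) => /eqP h.
  by rewrite /s mulrAC [u * _]mulrC h mulfK// gt_eqF.
have us : u <= s by rewrite uE ler_piMr ?cos_le1// ltW.
pose h t := atan (r * sin (t - al) / (s + r * cos (t - al))).
have cB : continuous (fun t : R => t - al).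
  by move=> t; apply: cvgB; [exact: cvg_id|exact: cvg_cst].
have ch : continuous h.
  move=> t; apply: (@continuous_cvg _ _ _ _ _ _ (@atan R)); first exact: continuous_atan.
  apply: cvgM.
    apply: cvgM; first exact: cvg_cst.
    by apply: (@continuous_cvg _ _ _ _ _ _ (@sin R)); [exact: continuous_sin|exact: cB].
  apply: cvgV.
    have := normr_mul_cos_le r (t - al); rewrite ler_norml => /andP[? _].
    by rewrite gt_eqF//; lra.
  apply: cvgD; first exact: cvg_cst.
  apply: cvgM; first exact: cvg_cst.
  by apply: (@continuous_cvg _ _ _ _ _ _ (@cos R)); [exact: continuous_cos|exact: cB].
have hN k t : h (2 * al + 2 * pi * k%:R - t) = - h t.
  have e : 2 * al + 2 * pi * k%:R - t - al = - (t - al) + pi *+ 2 *+ k.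
    by rewrite -mulr_natr -[pi *+ 2]mulr_natr; ring.
  rewrite /h e (periodicn (@sinD2pi R)) (periodicn (@cosD2pi R)) sinN cosN.
  by rewrite mulrN mulNr atanN.
have h0 : (\int[mu]_(t in `[0%R, (2 * pi)%R]) h t = 0)%R.
  (* The period is cut at [c] so that the two pieces are centered at [al + pi * k] and
     [al + pi * l], about which [h] is odd. The sign of [al] decides which cut falls inside the
     period. *)
  have split c (k l : nat) : 0 <= c -> c <= 2 * pi ->
      0 + c = 2 * al + 2 * pi * k%:R -> c + 2 * pi = 2 * al + 2 * pi * l%:R ->
      (\int[mu]_(t in `[0%R, (2 * pi)%R]) h t = 0)%R.
    move=> c0 c1 ck cl.
    rewrite (Rintegral_split ch c0 c1) !Rintegral_antisym ?addr0// => t.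
    - by rewrite cl hN.
    - by rewrite ck hN.
  case/andP: alb => ? ?; have [al0|al0] := leP 0 al.
    by apply: (split (2 * al) 0 1); rewrite //; lra.
  by apply: (split (2 * al + 2 * pi) 1 2); rewrite //; lra.
rewrite (_ : (\int[mu]_(t in `[0, 2 * pi]) _ = \int[mu]_(t in `[0, 2 * pi]) (al + h t))%R);
    last first.
  by apply: eq_Rintegral => t _; rewrite {1}uE {1}vE atan_add_polar// -uE.
rewrite RintegralD//; last 2 first.
  - by apply: continuous_integrable; exact: cst_continuous.
  - exact: continuous_integrable.
rewrite h0 addr0 Rintegral_segment_cst; last lra.
by rewrite subr0 mulrC.
Qed.

End circle_argument.

(** * The angle of the half-plane model *)

Section half_angle.
Context {R : realType}.
Implicit Types (z w a : R[i]) (r t x y : R).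
Local Notation mu := (@lebesgue_measure R).

Lemma unit_diskE x y : unit_disk R (x +i* y)%C = (x ^+ 2 + y ^+ 2 < 1).
Proof.
by apply/propext; rewrite /unit_disk/= -[in X in _ < X]sqrtr1 ltr_sqrt.
Qed.

Lemma unit_disk_Re x y : x ^+ 2 + y ^+ 2 < 1 -> -1 < x < 1.
Proof. by move=> h; apply/andP; split; nra. Qed.

Lemma continuous_Re : continuous (@complex.Re R : R[i]^o -> R).
Proof.
move=> z; apply/(@cvgrPdist_lt _ _ _ _ (nbhs_filter (z : R[i]^o))) => e e0.
apply: (@filterS _ _ (nbhs_filter (z : R[i]^o)) (ball (z : R[i]^o) (e%:C)%C)); last first.
  by apply: nbhsx_ballx; rewrite ltcR.
move=> w; rewrite -ball_normE /= => h.
rewrite -ltcR; apply: le_lt_trans h.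
by rewrite -raddfB; exact: normc_ge_Re.
Qed.

Lemma continuous_Im : continuous (@complex.Im R : R[i]^o -> R).
Proof.
move=> z; apply/(@cvgrPdist_lt _ _ _ _ (nbhs_filter (z : R[i]^o))) => e e0.
apply: (@filterS _ _ (nbhs_filter (z : R[i]^o)) (ball (z : R[i]^o) (e%:C)%C)); last first.
  by apply: nbhsx_ballx; rewrite ltcR.
move=> w; rewrite -ball_normE /= => h.
rewrite -ltcR; apply: le_lt_trans h.
have -> : complex.Im z - complex.Im w = complex.Re (- 'i * (z - w))%C.
  by case: z => ? ?; case: w => ? ?; simpc.
apply: le_trans (normc_ge_Re _) _.
have i1 : `|'i%C : R[i]| = 1.
  by rewrite normc_def/= expr0n/= expr1n add0r sqrtr1.
by rewrite normrM normrN i1 mul1r.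
Qed.

(* Half the argument of [i (1 + z) / (1 - z)], which ranges over the upper half
   plane: a positive harmonic function on the disk. *)
Definition half_angle z : R :=
  pi / 4 + (atan (complex.Im z / (1 + complex.Re z))
            + atan (complex.Im z / (1 - complex.Re z))) / 2.

(** Stated along an arbitrary filter so that it gives both continuity at a point of the disk and
    continuity along a circle. *)
Lemma cvg_half_angle (T : Type) (F : set_system T) (FF : Filter F)
    (f g : T -> R) x y : x ^+ 2 + y ^+ 2 < 1 ->
  f @ F --> x -> g @ F --> y ->
  half_angle (f t +i* g t)%C @[t --> F] --> half_angle (x +i* y)%C.
Proof.
move=> /unit_disk_Re/andP[x0 x1] fx gy; rewrite /half_angle /=.
apply: cvgD; first exact: cvg_cst.
apply: cvgM; last exact: cvg_cst.
apply: cvgD.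
  apply: (@continuous_cvg _ _ _ _ _ _ (@atan R)); first exact: continuous_atan.
  apply: cvgM => //; apply: cvgV; first by rewrite gt_eqF//; lra.
  by apply: cvgD => //; exact: cvg_cst.
apply: (@continuous_cvg _ _ _ _ _ _ (@atan R)); first exact: continuous_atan.
apply: cvgM => //; apply: cvgV; first by rewrite gt_eqF//; lra.
by apply: cvgB => //; exact: cvg_cst.
Qed.

Lemma circleE x y r t : (x +i* y + r%:C * (cos t +i* sin t))%C =
  ((x + r * cos t) +i* (y + r * sin t))%C.
Proof. by simpc. Qed.

(** The two linear bounds come from the points of the circle at [t = pi] and [t = 0]. *)
Lemma closed_disk_subset_unit_disk x y r : 0 < r ->
  [set z | normc (z - (x +i* y)%C) <= r] `<=` unit_disk R ->
  [/\ r < 1 + x, r < 1 - x &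
   forall t, (x + r * cos t) ^+ 2 + (y + r * sin t) ^+ 2 < 1].
Proof.
move=> r0 sub.
have cir t : (x + r * cos t) ^+ 2 + (y + r * sin t) ^+ 2 < 1.
  rewrite -unit_diskE; apply: sub => /=.
  rewrite [x + _]addrC [y + _]addrC !addrK !exprMn -mulrDr cos2Dsin2 mulr1.
  by rewrite sqrtr_sqr gtr0_norm.
split => //.
  by have /unit_disk_Re := cir pi; rewrite cospi => /andP[? _]; lra.
by have /unit_disk_Re := cir 0; rewrite cos0 => /andP[_ ?]; lra.
Qed.

Lemma continuous_half_angle_circle x y r :
  (forall t, (x + r * cos t) ^+ 2 + (y + r * sin t) ^+ 2 < 1) ->
  continuous (fun t : R => half_angle ((x + r * cos t) +i* (y + r * sin t))%C).
Proof.
move=> cir t; apply: cvg_half_angle => //.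
  apply: cvgD; first exact: cvg_cst.
  by apply: cvgM; [exact: cvg_cst|exact: continuous_cos].
apply: cvgD; first exact: cvg_cst.
by apply: cvgM; [exact: cvg_cst|exact: continuous_sin].
Qed.

(** The arctangents are the arguments of [1 + z] and, up to sign, of [1 - z]. Both points run along
    circles in the right half plane, the second one with [- r] in place of [r]. *)
Lemma Rintegral_half_angle x y r : 0 < r -> r < 1 + x -> r < 1 - x ->
  (forall t, (x + r * cos t) ^+ 2 + (y + r * sin t) ^+ 2 < 1) ->
  (\int[mu]_(t in `[0, 2 * pi])
    half_angle ((x + r * cos t) +i* (y + r * sin t))%C =
   2 * pi * half_angle (x +i* y)%C)%R.
Proof.
move=> r0 r1 r2 cir.
have pi0 := pi_gt0 R.
pose A t := atan ((y + r * sin t) / ((1 + x) + r * cos t)).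
pose B t := atan ((- y + - r * sin t) / ((1 - x) + - r * cos t)).
have cA : continuous A.
  move=> t; apply: (@continuous_cvg _ _ _ _ _ _ (@atan R)); first exact: continuous_atan.
  apply: cvgM.
    apply: cvgD; first exact: cvg_cst.
    by apply: cvgM; [exact: cvg_cst|exact: continuous_sin].
  apply: cvgV.
    by rewrite gt_eqF//; have /unit_disk_Re/andP[] := cir t; lra.
  apply: cvgD; first exact: cvg_cst.
  by apply: cvgM; [exact: cvg_cst|exact: continuous_cos].
have cB : continuous B.
  move=> t; apply: (@continuous_cvg _ _ _ _ _ _ (@atan R)); first exact: continuous_atan.
  apply: cvgM.
    apply: cvgD; first exact: cvg_cst.
    by apply: cvgM; [exact: cvg_cst|exact: continuous_sin].
  apply: cvgV.
    by rewrite gt_eqF//; have /unit_disk_Re/andP[] := cir t; lra.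
  apply: cvgD; first exact: cvg_cst.
  by apply: cvgM; [exact: cvg_cst|exact: continuous_cos].
have E t : half_angle ((x + r * cos t) +i* (y + r * sin t))%C =
    pi / 4 + 2^-1 * (A t - B t).
  rewrite /half_angle /A /B/= -atanN.
  have -> : 1 - x + - r * cos t = 1 - (x + r * cos t) by ring.
  have -> : - y + - r * sin t = - (y + r * sin t) by ring.
  rewrite mulNr opprK.
  by rewrite -(addrA 1 x) [2^-1 * _]mulrC.
have cAB : continuous (fun t => A t - B t).
  by move=> t; apply: cvgB; [exact: cA|exact: cB].
under eq_Rintegral => t _ do rewrite E.
rewrite RintegralD//; last 2 first.
  - by apply: continuous_integrable; exact: cst_continuous.
  - apply: continuous_integrable => t.
    by apply: cvgM; [exact: cvg_cst|exact: cAB].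
rewrite Rintegral_segment_cst; last lra.
rewrite RintegralZl//; last exact: continuous_integrable.
rewrite RintegralB//; try exact: continuous_integrable.
rewrite !Rintegral_atan_circle ?normrN ?gtr0_norm//; try lra.
rewrite /half_angle/= mulNr atanN; lra.
Qed.

End half_angle.

(** * Superharmonicity of concave functions of the angle *)

Section superharmonic.
Context {R : realType}.
Implicit Types (z w a : R[i]) (r t x y : R).
Local Notation mu := (@lebesgue_measure R).

(** Here [A + B] is the argument of [(1 + z) / (1 - z)], a positive multiple of
    [(1 - |z|^2) + 2 i y], and [tan th - 1 / tan th = 2 tan (A + B)] when [2 th = A + B + pi / 2].
    Since [s - s^-1] is injective for [s > 0], the identity determines the tangent and makes later
    computations with it algebraic. *)
Lemma half_angle_tan x y : x ^+ 2 + y ^+ 2 < 1 ->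
  [/\ 0 < half_angle (x +i* y)%C, half_angle (x +i* y)%C < pi / 2 &
   tan (half_angle (x +i* y)%C) - (tan (half_angle (x +i* y)%C))^-1 =
     4 * y / (1 - x ^+ 2 - y ^+ 2)].
Proof.
move=> D; have /andP[x0 x1] := unit_disk_Re D.
have pi0 := pi_gt0 R.
rewrite /half_angle/=; set A := atan (y / (1 + x)); set B := atan (y / (1 - x)).
have Ab : - (pi / 2) < A < pi / 2 by rewrite atan_gtNpi2 atan_ltpi2.
have Bb : - (pi / 2) < B < pi / 2 by rewrite atan_gtNpi2 atan_ltpi2.
have cA : 0 < cos A by exact: cos_gt0_pihalf.
have cB : 0 < cos B by exact: cos_gt0_pihalf.
have nx : 1 + x != 0 by rewrite gt_eqF//; lra.
have nx' : 1 - x != 0 by rewrite gt_eqF//; lra.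
have sA : sin A = cos A * (y / (1 + x)).
  have <- : tan A = y / (1 + x) by exact: atanK.
  by rewrite mulrC divfK// gt_eqF.
have sB : sin B = cos B * (y / (1 - x)).
  have <- : tan B = y / (1 - x) by exact: atanK.
  by rewrite mulrC divfK// gt_eqF.
have x2 : 0 < (1 + x) * (1 - x) by apply: mulr_gt0; lra.
set k := cos A * cos B / ((1 + x) * (1 - x)).
have k0 : 0 < k by rewrite /k divr_gt0// mulr_gt0.
have cS : cos (A + B) = k * (1 - x ^+ 2 - y ^+ 2).
  by rewrite /k cosD sA sB; field; rewrite nx nx'.
have sS : sin (A + B) = k * (2 * y).
  by rewrite /k sinD sA sB; field; rewrite nx nx'.
have w0 : 0 < 1 - x ^+ 2 - y ^+ 2 by lra.
have cS0 : 0 < cos (A + B) by rewrite cS mulr_gt0.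
have /andP[S0 S1] : - (pi / 2) < A + B < pi / 2.
  apply: cos_gt0_itv => //.
  by move: Ab Bb => /andP[? ?] /andP[? ?]; apply/andP; split; lra.
set th := pi / 4 + (A + B) / 2.
have th0 : 0 < th by rewrite /th; lra.
have th1 : th < pi / 2 by rewrite /th; lra.
split=> //.
have s0 : 0 < sin th by apply: sin_gt0_pihalf; rewrite th0.
have c0 : 0 < cos th by apply: cos_gt0_pihalf; apply/andP; split; lra.
have S2 : A + B = th *+ 2 - pi / 2 by rewrite /th mulr2n; lra.
have e1 : 2 * (cos th * sin th) = k * (1 - x ^+ 2 - y ^+ 2).
  by rewrite -cS S2 cosBpihalf sin_mulr2n mulr_natl.
have e2 : 1 - 2 * cos th ^+ 2 = k * (2 * y).
  by rewrite -sS S2 sinBpihalf cos_mulr2n opprB mulr_natl.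
have -> : 4 * y / (1 - x ^+ 2 - y ^+ 2) =
    2 * (1 - 2 * cos th ^+ 2) / (2 * (cos th * sin th)).
  by rewrite e1 e2; field; rewrite !gt_eqF.
have := cos2Dsin2 th => cs.
rewrite /tan invf_div.
have -> : 1 - 2 * cos th ^+ 2 = sin th ^+ 2 - cos th ^+ 2 by lra.
by field; rewrite !gt_eqF.
Qed.

Lemma half_angle_gt0 z : unit_disk R z -> 0 < half_angle z.
Proof. by case: z => x y; rewrite unit_diskE => /half_angle_tan[]. Qed.

Lemma half_angle_lt_pihalf z : unit_disk R z -> half_angle z < pi / 2.
Proof. by case: z => x y; rewrite unit_diskE => /half_angle_tan[]. Qed.

Lemma continuous_half_angle z : unit_disk R z ->
  {for z, continuous (half_angle : R[i]^o -> R)}.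
Proof.
case: z => x y; rewrite unit_diskE => D.
have := cvg_half_angle _ D (@continuous_Re R (x +i* y)%C) (@continuous_Im R (x +i* y)%C).
have -> : (fun w : R[i]^o => half_angle (complex.Re w +i* complex.Im w)%C) = half_angle.
  by apply/funext => -[].
by apply; exact: nbhs_filter.
Qed.

Lemma nbhs_half_angle_gt (G : R -> R) z b : unit_disk R z ->
  {for half_angle z, continuous G} -> b < G (half_angle z) ->
  nbhs (z : R[i]^o) [set w | b < G (half_angle w)].
Proof.
move=> Dz cGz bz.
have FF := nbhs_filter (z : R[i]^o).
have cz : G (half_angle w) @[w --> (z : R[i]^o)] --> G (half_angle z).
  apply: (@continuous_cvg _ _ _ _ FF _ G (half_angle z) cGz).
  exact: continuous_half_angle.
exact: (@cvgr_gt _ _ _ FF _ _ cz b bz).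
Qed.

Lemma circle_meanE (f : R -> R) (u : R[i] -> \bar R) a r : continuous f ->
  (forall t, u (a + r%:C * (cos t +i* sin t))%C = (f t)%:E) ->
  circle_mean u a r = ((2 * pi)^-1 * \int[mu]_(t in `[0, 2 * pi]) f t)%R%:E.
Proof.
move=> cf uE; rewrite /circle_mean EFinM; congr (_ * _)%E.
under eq_integral do rewrite uE.
rewrite /Rintegral fineK//; apply: integrable_fin_num => //.
exact: continuous_integrable.
Qed.

(** Jensen's inequality. Concavity is given by supporting lines: the one at the value of the angle
    at the center is integrated over the circle, where the angle has the mean value property. *)
Lemma superharmonic_half_angle (G : R -> R) :
  (forall y, 0 < y -> {for y, continuous G}) ->
  (forall y0, 0 < y0 -> exists b, forall y, 0 < y -> G y <= G y0 + b * (y - y0)) ->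
  superharmonic (fun z => (G (half_angle z))%:E).
Proof.
move=> cG concG; split.
- by move=> z _; exact: ltNyr.
- move=> z b; rewrite lte_fin => bz.
  have [Dz|Dz] := pselect (unit_disk R z); last first.
    (* A point outside the disk is isolated in the subspace topology. *)
    exists [set z]; last by move=> ? ->; rewrite lte_fin.
    have : nbhs_subspace (A := unit_disk R : set R[i]^o) z [set z].
      by rewrite -nbhs_subspace_out// => ? ->.
    by [].
  exists [set w | b < G (half_angle w)]; last by move=> w /=; rewrite lte_fin.
  have : nbhs_subspace (A := unit_disk R : set R[i]^o) z [set w | b < G (half_angle w)].
    rewrite -nbhs_subspace_in//.
    have cGz := cG _ (half_angle_gt0 Dz).
    by have := nbhs_half_angle_gt Dz cGz bz; apply: filterS => w ? _.
  by [].
- move=> [x y] r r0 sub.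
  have [r1 r2 cir] := closed_disk_subset_unit_disk r0 sub.
  pose th t := half_angle ((x + r * cos t) +i* (y + r * sin t))%C.
  have cth : continuous th by exact: continuous_half_angle_circle.
  have th0 t : 0 < th t by apply: half_angle_gt0; rewrite unit_diskE.
  have cGth : continuous (G \o th).
    by move=> t; apply: (@continuous_cvg _ _ _ _ _ _ G (th t)); [exact: cG|exact: cth].
  rewrite (circle_meanE cGth) => [|t]; last by rewrite circleE.
  set y0 := half_angle (x +i* y)%C.
  have [|b Gb] := concG y0.
    apply: half_angle_gt0; apply: sub => /=.
    by rewrite !subrr expr0n/= addr0 sqrtr0 ltW.
  have pi0 := pi_gt0 R.
  rewrite lee_fin mulrC ler_pdivrMr; last lra.
  have cl : continuous (fun t => b * (th t - y0)).
    move=> t; apply: cvgM; first exact: cvg_cst.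
    by apply: cvgB; [exact: cth|exact: cvg_cst].
  have cl' : continuous (fun t => G y0 + b * (th t - y0)).
    by move=> t; apply: cvgD; [exact: cvg_cst|exact: cl].
  have cl'' : continuous (fun t => th t - y0).
    by move=> t; apply: cvgB; [exact: cth|exact: cvg_cst].
  apply: (@le_trans _ _ (\int[mu]_(t in `[0, 2 * pi]) (G y0 + b * (th t - y0))))%R.
    apply: le_Rintegral => //; try exact: continuous_integrable.
    by move=> t _; exact: Gb.
  rewrite RintegralD//; last 2 first.
  - by apply: continuous_integrable; exact: cst_continuous.
  - exact: continuous_integrable.
  rewrite RintegralZl//; last exact: continuous_integrable.
  rewrite RintegralB//; last 2 first.
  - exact: continuous_integrable.
  - by apply: continuous_integrable; exact: cst_continuous.
  rewrite !Rintegral_segment_cst; [|lra..].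
  by rewrite Rintegral_half_angle// -/y0; lra.
- exists 0%C; last exact: ltry.
  by rewrite -[0%C]/(0 +i* 0)%C unit_diskE !expr0n/= addr0.
Qed.

End superharmonic.

(** * Comparison with the hyperbolic distance *)

Section hyperbolic_estimates.
Context {R : realType}.
Implicit Types (z w a : R[i]) (r s t u v x y l : R).

(** Since [s + s^-1 = 2 cosh (ln s)], this turns a comparison of hyperbolic cosines into one of
    logarithms. *)
Lemma le_of_addV_le l s : 0 < l -> 1 <= s -> l + l^-1 <= s + s^-1 -> l <= s.
Proof.
move=> l0 s1; have s0 : 0 < s by lra.
have -> : l + l^-1 = (l ^+ 2 + 1) / l by field; rewrite gt_eqF.
have -> : s + s^-1 = (s ^+ 2 + 1) / s by field; rewrite gt_eqF.
rewrite ler_pdivrMr// mulrAC ler_pdivlMr// => h.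
rewrite leNgt; apply/negP => sl.
have : 0 < (l - s) * (l * s - 1).
  by apply: mulr_gt0; [lra|nra].
by nra.
Qed.

Lemma subV_inj s t : 0 < s -> 0 < t -> s - s^-1 = t - t^-1 -> s = t.
Proof.
move=> s0 t0 h.
have : (s - t) * (1 + (s * t)^-1) = 0.
  transitivity ((s - s^-1) - (t - t^-1)); last by rewrite h subrr.
  by field; rewrite !gt_eqF.
move/eqP; rewrite mulf_eq0 subr_eq0 => /orP[/eqP//|].
by rewrite gt_eqF// addr_gt0// invr_gt0 mulr_gt0.
Qed.

Lemma tan_gt0 x : 0 < x < pi / 2 -> 0 < tan x.
Proof.
move=> /andP[x0 x1]; rewrite divr_gt0//; first by apply: sin_gt0_pihalf; rewrite x0.
by apply: cos_gt0_pihalf; rewrite x1 andbT; lra.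
Qed.

Lemma normc_sqr x y : normc (x +i* y)%C ^+ 2 = x ^+ 2 + y ^+ 2.
Proof. by rewrite /normc sqr_sqrtr// addr_ge0 ?sqr_ge0. Qed.

(** This rests on [|1 - z w^*|^2 = (1 - |z|^2) (1 - |w|^2) + |z - w|^2]. *)
Lemma pseudohyperbolic_sqr x y u v : x ^+ 2 + y ^+ 2 < 1 -> u ^+ 2 + v ^+ 2 < 1 ->
  let m := 1 - x ^+ 2 - y ^+ 2 in let n := 1 - u ^+ 2 - v ^+ 2 in
  let e := (x - u) ^+ 2 + (y - v) ^+ 2 in
  pseudohyperbolic (x +i* y)%C (u +i* v)%C ^+ 2 = e / (m * n + e).
Proof.
move=> Dz Dw m n e.
rewrite /pseudohyperbolic normcM normcV exprMn exprVn; congr (_ / _).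
  by simpc; rewrite normc_sqr.
rewrite -[1%R : R[i]]/((1 +i* 0)%C); simpc; rewrite normc_sqr /m /n /e; ring.
Qed.

Lemma pseudohyperbolic_ge0 z w : 0 <= pseudohyperbolic z w.
Proof. by rewrite /pseudohyperbolic; case: (_ / _) => ? ?; exact: sqrtr_ge0. Qed.

(* With [p = 1 + |z|^2], [E = |1 - z^2|] and likewise for [w], the claim is
   [cosh (ln T_z - ln T_w) <= cosh (2 rho)], which reduces to the inequality
   [E E' <= p p' - 4 x x'] where [E^2 = p^2 - 4 x^2]. *)
Lemma ln_tan_half_angle_lipschitz z w : unit_disk R z -> unit_disk R w ->
  `|ln (tan (half_angle z)) - ln (tan (half_angle w))| <= 2 * hyperbolic z w.
Proof.
case: z w => [x y] [u v]; rewrite !unit_diskE => Dz Dw.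
have [x0 x1 T1] := half_angle_tan Dz; have [u0 u1 T2] := half_angle_tan Dw.
have := pseudohyperbolic_sqr Dz Dw.
have := pseudohyperbolic_ge0 (x +i* y)%C (u +i* v)%C.
rewrite /hyperbolic mulrA divff ?pnatr_eq0// mul1r.
set d := pseudohyperbolic _ _ => d0 /= dE.
have S0 : 0 < tan (half_angle (x +i* y)%C) by rewrite tan_gt0// x0.
have T0 : 0 < tan (half_angle (u +i* v)%C) by rewrite tan_gt0// u0.
move: S0 T0 T1 T2; move: (tan _) (tan (half_angle (u +i* v)%C)) => S T S0 T0 SE TE.
set m := 1 - x ^+ 2 - y ^+ 2 in SE dE; set n := 1 - u ^+ 2 - v ^+ 2 in TE dE.
set e := (x - u) ^+ 2 + (y - v) ^+ 2 in dE.
have m0 : 0 < m by rewrite /m; lra.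
have n0 : 0 < n by rewrite /n; lra.
have mn0 : 0 < m * n by exact: mulr_gt0.
have e0 : 0 <= e by rewrite addr_ge0 ?sqr_ge0.
have d1 : d < 1.
  rewrite -(@ltr_pXn2r _ 2)// ?nnegrE// expr1n dE ltr_pdivrMr; lra.
(* [L] is [exp (2 rho)], so [L + L^-1] is [2 cosh (2 rho)]. *)
set L := (1 + d) / (1 - d).
have L1 : 1 <= L by rewrite /L ler_pdivlMr; lra.
have LE : m * n * (L + L^-1) = 2 * (m * n + 2 * e).
  have -> : L + L^-1 = 2 * (1 + d ^+ 2) / (1 - d ^+ 2).
    have h1 : 1 - d != 0 by rewrite gt_eqF//; lra.
    have h2 : 1 - d ^+ 2 != 0 by rewrite gt_eqF//; nra.
    have h3 : 1 + d != 0 by rewrite gt_eqF//; lra.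
    by rewrite /L; field; rewrite h1 h2 h3.
  have h4 : m * n + e != 0 by rewrite gt_eqF//; lra.
  have h5 : m * n != 0 by rewrite gt_eqF.
  have h6 : m * n + e - e != 0 by rewrite addrK.
  by rewrite dE; field; rewrite h4 h6.
have key : S / T + T / S <= L + L^-1.
  rewrite -(ler_pM2l mn0) LE.
  (* [a] is [|1 - z^2|] and [b] is [|1 - w^2|]: the square of [a] is [m^2 + 4 y^2], from the known
     value of [S - S^-1]. *)
  pose a := m * (S + S^-1) / 2; pose b := n * (T + T^-1) / 2.
  have a0 : 0 <= a.
    apply: divr_ge0 => //; apply: mulr_ge0; first exact: ltW.
    by apply: addr_ge0; rewrite ?invr_ge0 ltW.
  have b0 : 0 <= b.
    apply: divr_ge0 => //; apply: mulr_ge0; first exact: ltW.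
    by apply: addr_ge0; rewrite ?invr_ge0 ltW.
  have mS : m * (S - S^-1) = 4 * y by rewrite SE mulrC divfK// gt_eqF.
  have nT : n * (T - T^-1) = 4 * v by rewrite TE mulrC divfK// gt_eqF.
  have aE : a ^+ 2 = (1 + x ^+ 2 + y ^+ 2) ^+ 2 - 4 * x ^+ 2.
    have -> : a ^+ 2 = m ^+ 2 + (m * (S - S^-1)) ^+ 2 / 4.
      by rewrite /a; field; rewrite gt_eqF.
    by rewrite mS /m; field.
  have bE : b ^+ 2 = (1 + u ^+ 2 + v ^+ 2) ^+ 2 - 4 * u ^+ 2.
    have -> : b ^+ 2 = n ^+ 2 + (n * (T - T^-1)) ^+ 2 / 4.
      by rewrite /b; field; rewrite gt_eqF.
    by rewrite nT /n; field.
  have -> : m * n * (S / T + T / S) =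
      2 * (a * b) - (m * (S - S^-1)) * (n * (T - T^-1)) / 2.
    by rewrite /a /b; field; rewrite !gt_eqF.
  rewrite mS nT.
  pose p := 1 + x ^+ 2 + y ^+ 2; pose q := 1 + u ^+ 2 + v ^+ 2.
  have ab : a * b <= p * q - 4 * x * u.
    have /unit_disk_Re/andP[? ?] := Dz; have /unit_disk_Re/andP[? ?] := Dw.
    have pq0 : 0 <= p * q - 4 * x * u.
      have px : 2 * `|x| <= p.
        have := sqr_ge0 (`|x| - 1); have := real_normK (num_real x).
        by have := sqr_ge0 y; rewrite /p; nra.
      have qu : 2 * `|u| <= q.
        have := sqr_ge0 (`|u| - 1); have := real_normK (num_real u).
        by have := sqr_ge0 v; rewrite /q; nra.
      have : (2 * `|x|) * (2 * `|u|) <= p * q by apply: ler_pM => //; rewrite mulr_ge0.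
      have := ler_norm (x * u); rewrite normrM; lra.
    suff h : (a * b) ^+ 2 <= (p * q - 4 * x * u) ^+ 2.
      by move: h; rewrite ler_pXn2r// nnegrE mulr_ge0.
    rewrite exprMn aE bE -/p -/q -subr_ge0.
    have -> : (p * q - 4 * x * u) ^+ 2 - (p ^+ 2 - 4 * x ^+ 2) * (q ^+ 2 - 4 * u ^+ 2)
       = 4 * (p * u - q * x) ^+ 2 by ring.
    by rewrite mulr_ge0// sqr_ge0.
  have -> : 2 * (m * n + 2 * e) = 2 * (p * q - 4 * x * u) - 8 * y * v.
    by rewrite /m /n /e /p /q; ring.
  by lra.
have L0 : 0 < L by lra.
move: L L1 {LE} key L0 => L L1 key L0.
have l1 : ln S - ln T <= ln L.
  rewrite -ln_div ?posrE// ler_ln ?posrE ?divr_gt0//.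
  apply: le_of_addV_le => //; first exact: divr_gt0.
  by rewrite invf_div.
have l2 : ln T - ln S <= ln L.
  rewrite -ln_div ?posrE// ler_ln ?posrE ?divr_gt0//.
  apply: le_of_addV_le => //; first exact: divr_gt0.
  by rewrite invf_div addrC.
by rewrite ler_norml ; apply/andP; split; lra.
Qed.

End hyperbolic_estimates.

(** * Powers of the angle and of its tangent *)

Section elementary.
Context {R : realType}.
Implicit Types (q s t x y c : R).

Lemma sin_le x : 0 <= x -> sin x <= x.
Proof.
move=> x0; have [|c _] := @MVT_segment R sin cos 0 x x0 _.
  by apply: continuous_subspaceT; exact: continuous_sin.
by rewrite sin0 !subr0 => ->; rewrite ler_piMl// cos_le1.
Qed.

Lemma sin_mul_cos_le x : 0 <= x -> sin x * cos x <= x.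
Proof.
move=> x0; have := @sin_le (x *+ 2); rewrite sin_mulr2n mulrC mulrn_wge0//.
by move=> /(_ isT); rewrite lerMn2r.
Qed.

Lemma MVT_tan x y : - (pi / 2) < x -> x < y -> y < pi / 2 ->
  exists2 c, x < c < y & tan y - tan x = (cos c) ^- 2 * (y - x).
Proof.
move=> x0 xy y1.
have c0 c : x <= c -> c <= y -> cos c != 0.
  by move=> xc cy; rewrite gt_eqF// cos_gt0_pihalf//; apply/andP; split; lra.
have [||c] := @MVT R tan (fun c => (cos c) ^- 2) x y xy.
- move=> c; rewrite in_itv/= => /andP[xc cy]; apply: is_derive_tan.
  by apply: c0; exact: ltW.
- apply: derivable_within_continuous => c; rewrite in_itv/= => /andP[xc cy].
  by apply: derivable_tan; exact: c0.
by rewrite in_itv/= => cxy E; exists c.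
Qed.

Lemma tan_ge x : 0 < x < pi / 2 -> x <= tan x.
Proof.
move=> /andP[x0 x1]; have [||//|c /andP[c0 cx]] := @MVT_tan 0 x; [lra|by []|].
rewrite tan0 !subr0 => ->; apply: ler_peMl; first exact: ltW.
have cc : 0 < cos c by apply: cos_gt0_pihalf; apply/andP; split; lra.
by rewrite invf_ge1 ?exprn_gt0// expr_le1// ?cos_le1// ltW.
Qed.

(** [tan x / x] is nondecreasing: the slope of the chord of [tan] from [x] to [y] is at least
    [(cos x) ^- 2], hence at least [tan x / x] because [sin x * cos x <= x]. *)
Lemma mul_tan_le x y : 0 < x -> x <= y -> y < pi / 2 -> y * tan x <= x * tan y.
Proof.
move=> x0; rewrite le_eqVlt => /orP[/eqP ->//|xy] y1.
have pi0 := pi_gt0 R.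
have [|c /andP[xc cy] E] := @MVT_tan x y _ xy y1; first lra.
have cx : 0 < cos x by apply: cos_gt0_pihalf; apply/andP; split; lra.
have cc : 0 < cos c by apply: cos_gt0_pihalf; apply/andP; split; lra.
have cxc : cos c <= cos x.
  by apply/ltW; rewrite ltr_cos// in_itv/=; apply/andP; split; lra.
have tx : tan x <= x * (cos c) ^- 2.
  apply: (@le_trans _ _ (x * (cos x) ^- 2)).
    rewrite /tan expr2 invfM mulrA ler_pM2r ?invr_gt0// ler_pdivlMr//.
    by apply: sin_mul_cos_le; exact: ltW.
  by rewrite ler_pM2l// lef_pV2 ?posrE ?exprn_gt0// lerXn2r// nnegrE ltW.
have -> : tan y = tan x + (cos c) ^- 2 * (y - x) by lra.
nra.
Qed.

(** This carries the Lipschitz bound for [ln (tan x)] over to [ln x]. *)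
Lemma ln_le_ln_tan x y : 0 < x -> x <= y -> y < pi / 2 ->
  0 <= ln y - ln x <= ln (tan y) - ln (tan x).
Proof.
move=> x0 xy y1; have y0 : 0 < y by lra.
have tx : 0 < tan x by apply: tan_gt0; rewrite x0/=; lra.
have ty : 0 < tan y by apply: tan_gt0; rewrite y0.
rewrite subr_ge0 ler_ln ?posrE// xy/=.
have : ln (y * tan x) <= ln (x * tan y).
  by rewrite ler_ln ?posrE; [exact: mul_tan_le|exact: mulr_gt0..].
by rewrite (lnM y0 tx) (lnM x0 ty); lra.
Qed.

(** Weighted arithmetic-geometric inequality for [t] and [1]: add [ln s <= s - 1] at [s = t / m] and
    [s = 1 / m] with weights [q] and [1 - q]; the right-hand sides cancel. *)
Lemma powR_le_tangent q t : 0 < q < 1 -> 0 < t -> t `^ q <= 1 + q * (t - 1).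
Proof.
move=> /andP[q0 q1] t0; set m := 1 + _.
have m0 : 0 < m by rewrite /m; nra.
have tq0 : 0 < t `^ q by exact: powR_gt0.
rewrite -ler_ln ?posrE// ln_powR.
have ln_le x : 0 < x -> ln x <= x - 1.
  by move=> x0; have := @le_ln1Dx R (x - 1); rewrite [1 + _]addrC subrK; apply; lra.
have h1 := ln_le (t / m) (divr_gt0 t0 m0).
have m1 : 0 < m^-1 by rewrite invr_gt0.
have h2 := ln_le (m^-1) m1.
rewrite ln_div ?posrE// in h1; rewrite lnV ?posrE// in h2.
have : q * (ln t - ln m) + (1 - q) * - ln m <= q * (t / m - 1) + (1 - q) * (m^-1 - 1).
  by apply: lerD; rewrite ler_pM2l//; lra.
have -> : q * (t / m - 1) + (1 - q) * (m^-1 - 1) = 0.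
  by rewrite /m; field; rewrite gt_eqF.
lra.
Qed.

Lemma powR_tangent q y y0 : 0 < q < 1 -> 0 < y0 -> 0 < y ->
  y `^ q <= y0 `^ q + (q * y0 `^ q / y0) * (y - y0).
Proof.
move=> q01 y00 yy; have := powR_le_tangent q01 (divr_gt0 yy y00).
have yE : y = (y / y0) * y0 by rewrite divfK// gt_eqF.
have p0 : 0 < y0 `^ q by exact: powR_gt0.
have t0 : 0 <= y / y0 by apply: divr_ge0; exact: ltW.
move=> h; rewrite {1}yE (powRM _ t0 (ltW y00)).
apply: (@le_trans _ _ ((1 + q * (y / y0 - 1)) * y0 `^ q)); first by rewrite ler_pM2r.
by rewrite le_eqVlt; apply/orP; left; apply/eqP; field; rewrite gt_eqF.
Qed.

(** The linear error is negligible against [x^q] as [x -> 0]. Below the cap,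
    [tan x <= x (1 + tan^2 x)] gives first [tan x <= 5 x], then [tan x <= x (1 + 10 x)]; the factor
    [x^q <= 2] turns [10 x] into [20 x]. Above the cap [x >= pi / 4], and [20 x] alone suffices. *)
Lemma min_tan_powR_le q x : 0 < q < 1 -> 0 < x < pi / 2 ->
  (Num.min (tan x) 2) `^ q <= x `^ q + 20 * x.
Proof.
move=> /andP[q0 q1] x01; have /andP[x0 x1] := x01.
have pi0 := pi_ge2 R.
have t0 := tan_gt0 x01.
have pow_le2 s : 0 < s -> s <= 2 -> s `^ q <= 2.
  move=> s0 s2; apply: (@le_trans _ _ (2 `^ q)).
    by apply: (ge0_ler_powR (ltW q0)) => //; rewrite nnegrE ltW.
  by rewrite -[leRHS]powRr1// ler_powR// ?ler1n// ltW.
have [t2|t2] := leP (tan x) 2; last first.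
  have xp : pi / 4 <= x.
    rewrite leNgt; apply/negP => xp.
    have : tan x < tan (pi / 4).
      by rewrite ltr_tan// in_itv/=; apply/andP; split; lra.
    by rewrite tan_piquarter; lra.
  by have := pow_le2 2; have := powR_ge0 x q; lra.
have cx : 0 < cos x by apply: cos_gt0_pihalf; rewrite x1 andbT; lra.
have t1 : tan x <= x * (1 + tan x ^+ 2).
  rewrite -cos2_tan2 ?gt_eqF// /tan expr2 invfM mulrA ler_pM2r ?invr_gt0//.
  by rewrite ler_pdivlMr// sin_mul_cos_le// ltW.
have t4 : tan x ^+ 2 <= 2 * tan x by rewrite expr2 ler_pM2r.
have t5 : tan x <= 5 * x.
  by apply: le_trans t1 _; rewrite mulrC ler_pM2r//; lra.
have t3 : tan x <= x * (1 + 10 * x).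
  by apply: le_trans t1 _; rewrite ler_pM2l//; lra.
have xq : x `^ q <= 2.
  by apply: pow_le2 => //; have := pihalf_lt2 R; lra.
apply: (@le_trans _ _ ((x * (1 + 10 * x)) `^ q)).
  apply: (ge0_ler_powR (ltW q0)) => //; rewrite nnegrE; first exact: ltW.
  by apply: mulr_ge0; lra.
have x10 : 0 <= 1 + 10 * x by lra.
rewrite (powRM _ (ltW x0) x10).
have h : (1 + 10 * x) `^ q <= 1 + 10 * x by apply: ler1_powR; lra.
have p0 := powR_gt0 q x0.
apply: (@le_trans _ _ (x `^ q * (1 + 10 * x))); first by rewrite ler_pM2l.
rewrite mulrDr mulr1 lerD2l.
have -> : 20 * x = 2 * (10 * x) by lra.
by rewrite ler_pM2r//; lra.
Qed.

End elementary.

(** * A circle mean greater than the value at the center *)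

Section circle_lower_bound.
Context {R : realType}.
Implicit Types (q s t x y a b c : R).
Local Notation mu := (@lebesgue_measure R).

(* Unlike [ge0_le_integral], no measurability is needed. *)
Lemma nonneg_le_integral (D : set R) (f g : R -> \bar R) :
  (forall x, D x -> (0 <= f x)%E) -> (forall x, D x -> (f x <= g x)%E) ->
  (\int[mu]_(x in D) f x <= \int[mu]_(x in D) g x)%E.
Proof.
move=> f0 fg; rewrite !ge0_integralE//; last by move=> x Dx; exact: le_trans (f0 x Dx) (fg x Dx).
apply: ereal_sup_le => _ [h hf <-]; exists h => // x.
exact: le_trans (hf x) (lee_restrict fg x).
Qed.

Lemma Rintegral_gt0 (g : R -> R) a b c : a < c < b -> continuous g ->
  (forall t, 0 <= g t) -> 0 < g c -> (0 < \int[mu]_(t in `[a, b]) g t)%R.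
Proof.
move=> /andP[ac cb] cg g0 gc.
have : \forall t \near c, [/\ g c / 2 < g t, a < t & t < b].
  have n1 : \forall t \near c, g c / 2 < g t by apply: (cvgr_gt _ (cg c)); lra.
  have n2 : \forall t \near c, a < t by exact: lt_nbhsr.
  have n3 : \forall t \near c, t < b by exact: lt_nbhsl.
  by apply: filterS3 n1 n2 n3 => t.
move=> /nbhs_ballP[e /= e0 be].
pose d := c + e / 2.
have cd t : c <= t -> t <= d -> [/\ g c / 2 < g t, a < t & t < b].
  move=> ct td; apply: be; rewrite /ball/= ltr_norml; rewrite /d in td.
  by apply/andP; split; lra.
have [_ _ db] : [/\ g c / 2 < g d, a < d & d < b] by apply: cd; rewrite /d; lra.
have c_d : c < d by rewrite /d; lra.
have acd : a <= d by lra.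
rewrite (Rintegral_split cg (ltW ac) (ltW cb)) (Rintegral_split cg (ltW c_d) (ltW db)).
have i1 : (0 <= \int[mu]_(t in `[a, c]) g t)%R by exact: Rintegral_ge0.
have i3 : (0 <= \int[mu]_(t in `[d, b]) g t)%R by exact: Rintegral_ge0.
have i2 : ((g c / 2) * (d - c) <= \int[mu]_(t in `[c, d]) g t)%R.
  rewrite -Rintegral_segment_cst; last exact: ltW.
  apply: le_Rintegral => //.
  - by apply: continuous_integrable; exact: cst_continuous.
  - exact: continuous_integrable.
  - by move=> t; rewrite /= in_itv/= => /andP[ct td]; case: (cd t ct td) => /ltW.
have p0 : 0 < (g c / 2) * (d - c) by apply: mulr_gt0; rewrite ?subr_gt0// divr_gt0.
by apply: ltr_wpDl i1 _; apply: ltr_pwDl (lt_le_trans p0 i2) i3.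
Qed.

Lemma continuous_powRr q y : 0 < y -> {for y, continuous (fun x : R => x `^ q)}.
Proof.
move=> y0; apply/differentiable_continuous/derivable1_diffP.
by apply: derivable_powR; rewrite in_itv/= y0.
Qed.

Lemma third_circle_disk t : (0 + 3^-1 * cos t) ^+ 2 + (0 + 3^-1 * sin t) ^+ 2 < 1 :> R.
Proof.
rewrite !add0r !exprMn -mulrDr cos2Dsin2 mulr1; lra.
Qed.

(** The radius [1 / 3] makes [4 r / (1 - r^2) = 3 / 2 = 2 - 1 / 2], so the tangent does not exceed
    the cap [2] on this circle. *)
Definition third_circle_tan t : R :=
  tan (half_angle ((0 + 3^-1 * cos t) +i* (0 + 3^-1 * sin t))%C).

Lemma third_circle_tan_gt0 t : 0 < third_circle_tan t.
Proof.
by apply: tan_gt0; have [-> ->] := half_angle_tan (third_circle_disk t).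
Qed.

Lemma third_circle_tanBV t :
  third_circle_tan t - (third_circle_tan t)^-1 = 3 / 2 * sin t.
Proof.
have [_ _] := half_angle_tan (third_circle_disk t); rewrite -/(third_circle_tan t) => ->.
have -> : 1 - (0 + 3^-1 * cos t) ^+ 2 - (0 + 3^-1 * sin t) ^+ 2 = 8 / 9 :> R.
  by rewrite !add0r !exprMn -addrA -opprD -mulrDr cos2Dsin2; field.
by field.
Qed.

Lemma third_circle_tan_le2 t : third_circle_tan t <= 2.
Proof.
rewrite leNgt; apply/negP => h; have := third_circle_tanBV t.
have : (third_circle_tan t)^-1 < 2^-1 by rewrite ltf_pV2 ?posrE ?third_circle_tan_gt0.
have := sin_le1 t; lra.
Qed.

(** Complex conjugation changes the sign of [T - T^-1], and so does inverting [T]. The reflection is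
    written as [Rintegral_antisym] expects it. *)
Lemma third_circle_tanV t : third_circle_tan (0 + 2 * pi - t) = (third_circle_tan t)^-1.
Proof.
apply: subV_inj; rewrite ?invr_gt0 ?third_circle_tan_gt0// invrK third_circle_tanBV.
rewrite -(opprB (third_circle_tan t)) third_circle_tanBV -mulrN; congr (_ * _).
have -> : 0 + 2 * pi - t = - t + pi *+ 2 by rewrite mulr2n; lra.
by rewrite sinD2pi sinN.
Qed.

Lemma continuous_third_circle_tan : continuous third_circle_tan.
Proof.
move=> t; apply: (@continuous_cvg _ _ _ _ _ _ (@tan R)
    (half_angle ((0 + 3^-1 * cos t) +i* (0 + 3^-1 * sin t))%C)).
  apply: continuous_tan; rewrite gt_eqF//; apply: cos_gt0_pihalf.
  by have [h ->] := half_angle_tan (third_circle_disk t); rewrite andbT; have := pi_gt0 R; lra.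
exact: (continuous_half_angle_circle third_circle_disk).
Qed.

(* [T^q + T^-q > 2] except where [T = 1]: pair the points symmetric about the
   real axis, at which the values of [T] are mutually inverse. *)
Lemma Rintegral_third_circle_powR_gt q : 0 < q ->
  (2 * pi < \int[mu]_(t in `[0, 2 * pi]) (third_circle_tan t `^ q))%R.
Proof.
move=> q0; have pi0 := pi_gt0 R.
pose P t := third_circle_tan t `^ q.
have P0 t : 0 < P t by apply: powR_gt0; exact: third_circle_tan_gt0.
have cP : continuous P.
  move=> t; apply: (@continuous_cvg _ _ _ _ _ _ (fun x : R => x `^ q) (third_circle_tan t)).
    by apply: continuous_powRr; exact: third_circle_tan_gt0.
  exact: continuous_third_circle_tan.
have cV : continuous (fun t => (P t)^-1).
  by move=> t; apply: cvgV; [rewrite gt_eqF|exact: cP].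
have PV t : P (0 + 2 * pi - t) = (P t)^-1.
  rewrite /P third_circle_tanV -powRN -powR_inv1; last exact/ltW/third_circle_tan_gt0.
  by rewrite -powRrM mulN1r.
have cB : continuous (fun t => P t - (P t)^-1).
  by move=> t; apply: cvgB; [exact: cP|exact: cV].
(* Hence [P] and its inverse have the same integral, and it suffices that [P + P^-1] has integral
   greater than [4 pi]. *)
have h : (\int[mu]_(t in `[0, 2 * pi]) (P t - (P t)^-1) = 0)%R.
  apply: Rintegral_antisym => // [|t]; first lra.
  by rewrite PV invrK opprB.
have cD : continuous (fun t => P t + (P t)^-1).
  by move=> t; apply: cvgD; [exact: cP|exact: cV].
have c2 : continuous (fun t => P t + (P t)^-1 - 2).
  by move=> t; apply: cvgB; [exact: cD|exact: cst_continuous].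
have E t : P t + (P t)^-1 - 2 = (P t - 1) ^+ 2 / P t.
  by field; rewrite gt_eqF.
have : (0 < \int[mu]_(t in `[0%R, (2 * pi)%R]) (P t + (P t)^-1 - 2))%R.
  (* At [pi / 2] one has [T - T^-1 = 3 / 2], which excludes [T = 1] and makes the integrand
     positive. *)
  apply: (@Rintegral_gt0 _ _ _ (pi / 2)) => //.
  - by apply/andP; split; lra.
  - by move=> t; rewrite E divr_ge0 ?sqr_ge0// ltW.
  rewrite E divr_gt0// exprn_even_gt0//= subr_eq0.
  apply/eqP => P1.
  have := third_circle_tanBV (pi / 2); rewrite sin_pihalf.
  have -> : third_circle_tan (pi / 2) = 1.
    apply: (@powR_injective R q) => //; last by rewrite powR1.
      by rewrite nnegrE; exact/ltW/third_circle_tan_gt0.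
    by rewrite nnegrE.
  by rewrite invr1; lra.
rewrite RintegralB//; last 2 first.
- exact: continuous_integrable.
- by apply: continuous_integrable; exact: cst_continuous.
rewrite RintegralD//; try exact: continuous_integrable.
rewrite RintegralB// in h; try exact: continuous_integrable.
rewrite Rintegral_segment_cst; last lra.
by rewrite -/(P _); lra.
Qed.

End circle_lower_bound.

(** * Reduced functions *)

Section reduced_functions.
Context {R : realType}.
Implicit Types (z w : R[i]) (q t x y c C : R).
Local Notation mu := (@lebesgue_measure R).

Lemma tan_half_angle_gt0 z : unit_disk R z -> 0 < tan (half_angle z).
Proof. by move=> Dz; rewrite tan_gt0// half_angle_gt0// half_angle_lt_pihalf. Qed.

Lemma unit_disk0 : unit_disk R 0%C.
Proof. by rewrite -[0%C]/(0 +i* 0)%C unit_diskE !expr0n/= addr0. Qed.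

Lemma half_angle0 : half_angle (0%C : R[i]) = pi / 4.
Proof. by rewrite /half_angle/= !mul0r atan0 addr0 mul0r addr0. Qed.

Lemma hyperbolic_ge0 z w : unit_disk R z -> unit_disk R w -> 0 <= hyperbolic z w.
Proof.
move=> Dz Dw; rewrite -(@pmulr_rge0 _ 2)//.
exact: le_trans (normr_ge0 _) (ln_tan_half_angle_lipschitz Dz Dw).
Qed.

Lemma hyperbolic_refl z : hyperbolic z z = 0.
Proof.
by rewrite /hyperbolic /pseudohyperbolic subrr mul0r normc0 addr0 subr0 divr1 ln1 mulr0.
Qed.

(** The point is [i v] with [t = (1 + v) / (1 - v)], between [-i] and [0]. The tangent is [1] at
    [0], so this is the equality case of the Lipschitz bound. *)
Lemma exists_tan_half_angle t : 0 < t < 1 -> exists z : R[i],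
  [/\ unit_disk R z, tan (half_angle z) = t & hyperbolic 0%C z = - (ln t / 2)].
Proof.
move=> /andP[t0 t1]; pose v := (t - 1) / (t + 1).
have tp : t + 1 != 0 by rewrite gt_eqF//; lra.
have D0 : 0 ^+ 2 + 0 ^+ 2 < 1 :> R by rewrite !expr0n/= addr0.
have v1 : 1 - v ^+ 2 = 4 * t / (t + 1) ^+ 2 by rewrite /v; field.
have v2 : 0 < 1 - v ^+ 2 by rewrite v1 divr_gt0 ?mulr_gt0 ?exprn_gt0//; lra.
have Dv : 0 ^+ 2 + v ^+ 2 < 1 by rewrite expr0n/= add0r; lra.
exists (0 +i* v)%C; split; first by rewrite unit_diskE.
  have [h0 h1 E] := half_angle_tan Dv.
  apply: subV_inj => //; first by rewrite tan_gt0// h0.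
  rewrite E expr0n/= subr0 v1 /v; field.
  by rewrite tp gt_eqF.
have d0 := pseudohyperbolic_ge0 (0 +i* 0)%C (0 +i* v)%C.
have dE : pseudohyperbolic (0 +i* 0)%C (0 +i* v)%C = (1 - t) / (1 + t).
  have t3 : 0 <= (1 - t) / (1 + t) by rewrite divr_ge0//; lra.
  apply/eqP; rewrite -(@eqrXn2 _ 2)//; apply/eqP.
  rewrite (pseudohyperbolic_sqr D0 Dv) /v; field.
  by rewrite sqrrN subrK addrC tp sqrf_eq0.
change (hyperbolic (0 +i* 0)%C (0 +i* v)%C = - (ln t / 2)).
rewrite /hyperbolic dE.
have -> : (1 + (1 - t) / (1 + t)) / (1 - (1 - t) / (1 + t)) = t^-1.
  by field; rewrite addrC tp/= gt_eqF//; lra.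
by rewrite lnV ?posrE//; lra.
Qed.

Lemma ln_half_angle_lipschitz z w : unit_disk R z -> unit_disk R w ->
  `|ln (half_angle z) - ln (half_angle w)| <= 2 * hyperbolic z w.
Proof.
move=> Dz Dw; apply: le_trans (ln_tan_half_angle_lipschitz Dz Dw).
have z0 := half_angle_gt0 Dz; have z1 := half_angle_lt_pihalf Dz.
have w0 := half_angle_gt0 Dw; have w1 := half_angle_lt_pihalf Dw.
have [zw|/ltW wz] := leP (half_angle z) (half_angle w).
  have /andP[a b] := ln_le_ln_tan z0 zw w1.
  by rewrite distrC [leRHS]distrC !ger0_norm//; lra.
have /andP[a b] := ln_le_ln_tan w0 wz z1.
by rewrite !ger0_norm//; lra.
Qed.

Lemma superharmonic_powR q c : 0 < q < 1 ->
  superharmonic (fun z : R[i] => (half_angle z `^ q + c * half_angle z)%:E).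
Proof.
move=> q01; apply: (superharmonic_half_angle (G := fun y => y `^ q + c * y)).
  move=> y y0; apply: cvgD; first exact: continuous_powRr.
  by apply: cvgM; [exact: cvg_cst|exact: cvg_id].
move=> y0 y00; exists (q * y0 `^ q / y0 + c) => y yy.
by have := powR_tangent q01 y00 yy; lra.
Qed.

Lemma half_angle_powR_le2 q z : 0 < q < 1 -> unit_disk R z -> half_angle z `^ q <= 2.
Proof.
move=> /andP[q0 q1] Dz; have z0 := half_angle_gt0 Dz; have z1 := half_angle_lt_pihalf Dz.
apply: (@le_trans _ _ (2 `^ q)).
  apply: (ge0_ler_powR (ltW q0)); rewrite ?nnegrE//; first exact: ltW.
  by have := pihalf_lt2 R; lra.
by rewrite -[leRHS]powRr1// ler_powR// ?ler1n// ltW.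
Qed.

Lemma log_lipschitz_half_angle_powR q : 0 < q ->
  log_lipschitz (2 * q) (fun z : R[i] => half_angle z `^ q).
Proof.
move=> q0; split=> [z Dz|z w Dz Dw]; first by apply: powR_gt0; exact: half_angle_gt0.
rewrite !ln_powR -mulrBr normrM gtr0_norm// [2 * q]mulrC -mulrA ler_pM2l//.
exact: ln_half_angle_lipschitz.
Qed.

Lemma le_log_lipschitz_majorant C (phi : R[i] -> R) z w : unit_disk R w ->
  ((phi w * expR (- (C * hyperbolic w z)))%:E <= log_lipschitz_majorant C phi z)%E.
Proof. by move=> Dw; apply: ereal_sup_ubound; exists w. Qed.

Lemma le_reduced (phi : R[i] -> \bar R) z : unit_disk R z -> (phi z <= reduced phi z)%E.
Proof. by move=> Dz; apply: le_ereal_inf_tmp => _ [u [_ +] <-]; exact. Qed.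

(** * The case [gamma < beta] *)

Lemma reduced_neq_of_lt gamma beta : 0 < gamma -> gamma < beta -> beta < 2 ->
  exists2 z, unit_disk R z &
    reduced (log_lipschitz_majorant gamma (fun z : R[i] => half_angle z `^ (beta / 2))) z
      <> log_lipschitz_reduced beta (fun z => half_angle z `^ (beta / 2)) z.
Proof.
move=> g0 gb b2; set q := beta / 2; set p := gamma / 2.
have q01 : 0 < q < 1 by rewrite /q; apply/andP; split; lra.
have pq : 0 < q - p by rewrite /q /p; lra.
have /andP[q0 q1] := q01.
(* Chosen so that [t^q = t^p / 4]. At the point [z] with tangent [t], the function is at most [t^q],
   while its majorant is at least [(pi / 4)^q t^p], hence at least [t^p / 2]. *)
pose t := 4^-1 `^ (q - p)^-1 : R.
have t0 : 0 < t by apply: powR_gt0.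
have tE : t `^ (q - p) = 4^-1 by rewrite /t -powRrM mulVf ?gt_eqF// powRr1.
have t1 : t < 1.
  rewrite ltNge; apply/negP => h.
  have := ler_powR h (ltW pq); rewrite powRr0 tE; lra.
have [z [Dz zt hz]] := exists_tan_half_angle (t := t) (introT andP (conj t0 t1)).
exists z => // /esym E.
(* The left side is the contribution of the origin to the majorant at [z]. The right side bounds
   [R_beta H] because [H] is itself an admissible function. *)
have : ((half_angle (0%C : R[i]) `^ q * expR (- (gamma * hyperbolic 0%C z)))%:E <=
        (half_angle z `^ q)%:E)%E.
  apply: le_trans
    (le_log_lipschitz_majorant gamma (fun z => half_angle z `^ q) z unit_disk0) _.
  apply: le_trans (le_reduced _ Dz) _; rewrite -E.
  apply: ereal_inf_lbound; exists (fun z => half_angle z `^ q) => //; split => //.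
    have := superharmonic_powR 0 q01.
    by under eq_fun do rewrite mul0r addr0.
  have -> : beta = 2 * q by rewrite /q; lra.
  exact: log_lipschitz_half_angle_powR.
rewrite lee_fin half_angle0 hz.
have -> : - (gamma * - (ln t / 2)) = p * ln t by rewrite /p; lra.
have -> : expR (p * ln t) = t `^ p by rewrite /powR gt_eqF.
apply/negP; rewrite -ltNge.
have hq : half_angle z `^ q <= t `^ q.
  have z0 := half_angle_gt0 Dz.
  apply: (ge0_ler_powR (ltW q0)); rewrite ?nnegrE ?(ltW t0) ?(ltW z0)//.
  by rewrite -zt; apply: tan_ge; rewrite z0 half_angle_lt_pihalf.
apply: le_lt_trans hq _.
have -> : t `^ q = t `^ p * 4^-1.
  rewrite -tE -powRD; first by rewrite addrC subrK.
  by rewrite (gt_eqF t0) implybT.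
rewrite mulrC ltr_pM2r ?powR_gt0//.
have : 2^-1 `^ q <= (pi / 4) `^ q :> R.
  apply: (ge0_ler_powR (ltW q0)); rewrite ?nnegrE//; have := pi_ge2 R; lra.
have : 2^-1 <= 2^-1 `^ q :> R.
  by apply: ger1_powR; [apply/andP; split; lra|exact: ltW].
lra.
Qed.

(** * The case [gamma = beta] *)

(** The cap makes the function bounded, since the tangent blows up towards the upper half of the
    unit circle. *)
Definition capped_tan q z : R := Num.min (tan (half_angle z)) 2 `^ q.

Lemma capped_tan_gt0 q z : unit_disk R z -> 0 < capped_tan q z.
Proof. by move=> Dz; rewrite powR_gt0// lt_min tan_half_angle_gt0/=. Qed.

(** Capping by a constant preserves the Lipschitz bound on the logarithm of the tangent, because the
    factor [E] is at least [1]. *)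
Lemma log_lipschitz_majorant_capped_tan q z : 0 < q -> unit_disk R z ->
  (log_lipschitz_majorant (2 * q) (capped_tan q) z <= (capped_tan q z)%:E)%E.
Proof.
rewrite /capped_tan => q0 Dz; apply: ge_ereal_sup => _ [w Dw <-]; rewrite lee_fin.
have := ln_tan_half_angle_lipschitz Dw Dz.
have := tan_half_angle_gt0 Dz; have := tan_half_angle_gt0 Dw.
move: (tan _) (tan (half_angle z)) => S T S0 T0; rewrite ler_norml => /andP[_ h].
have r0 := hyperbolic_ge0 Dw Dz; set r := hyperbolic w z in h r0 *.
have m0 x : 0 < x -> 0 < Num.min x 2 :> R by move=> x0; rewrite lt_min x0/=.
pose E := expR (2 * r).
have E1 : 1 <= E by rewrite /E -expR0 ler_expR mulr_ge0.
have ST : S <= T * E.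
  by rewrite -ler_ln ?posrE ?mulr_gt0 ?expR_gt0// lnM ?posrE ?expR_gt0// expRK; lra.
have mST : Num.min S 2 <= Num.min T 2 * E.
  case: (leP T 2) => T2; first by rewrite ge_min ST.
  by rewrite ge_min [X in _ || X](_ : _ = true) ?orbT// ler_peMr.
rewrite expRN ler_pdivrMr ?expR_gt0//.
have -> : 2 * q * r = 2 * r * q by lra.
rewrite expRM -powRM ?expR_ge0//; last exact/ltW/m0.
apply: (ge0_ler_powR (ltW q0)) => //; rewrite nnegrE; first exact/ltW/m0.
by rewrite mulr_ge0 ?expR_ge0//; exact/ltW/m0.
Qed.

(** The contradiction uses equality both at [0] and at points tending to [-i], so equality is
    supposed on the whole disk and the point where it fails is not exhibited. *)
Lemma reduced_neq_diagonal beta : 0 < beta -> beta < 2 ->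
  let H := capped_tan (beta / 2) in
  exists2 z, unit_disk R z &
    reduced (log_lipschitz_majorant beta H) z <> log_lipschitz_reduced beta H z.
Proof.
move=> b0 b2; set q := beta / 2; move=> H.
have q01 : 0 < q < 1 by rewrite /q; apply/andP; split; lra.
have /andP[q0 q1] := q01.
have bE : beta = 2 * q by rewrite /q; lra.
apply: contrapT => noz.
have eqz z : unit_disk R z ->
    reduced (log_lipschitz_majorant beta H) z = log_lipschitz_reduced beta H z.
  by move=> Dz; apply: contrapT => ne; apply: noz; exists z.
pose M := ((2 * pi)^-1 * \int[mu]_(t in `[0, 2 * pi]) (third_circle_tan t `^ q))%R.
have pi0 := pi_gt0 R.
have M1 : 1 < M.
  by rewrite /M mulrC ltr_pdivlMr ?mul1r ?mulr_gt0//; exact: Rintegral_third_circle_powR_gt.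
have HL z : unit_disk R z -> ((H z)%:E <= log_lipschitz_majorant beta H z)%E.
  move=> Dz; have := le_log_lipschitz_majorant beta H z Dz.
  by rewrite hyperbolic_refl mulr0 oppr0 expR0 mulr1.
(* [M] is the mean of [H] over the circle of radius [1 / 3], and a superharmonic function above [H]
   is at least its own circle mean at the center. *)
have MH : (M%:E <= reduced (log_lipschitz_majorant beta H) (0 : R[i])%R)%E.
  apply: le_ereal_inf_tmp => _ [u [su uL] <-].
  have third_in t : unit_disk R ((0 +i* 0) + (3^-1)%:C * (cos t +i* sin t))%C.
    by rewrite circleE unit_diskE third_circle_disk.
  have cP : continuous (fun t : R => third_circle_tan t `^ q).
    move=> t; apply: (@continuous_cvg _ _ _ _ _ _ (fun x : R => x `^ q) (third_circle_tan t)).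
      by apply: continuous_powRr; exact: third_circle_tan_gt0.
    exact: continuous_third_circle_tan.
  apply: le_trans (superharmonic_mean su (a := 0%C) (r := 3^-1) _ _); last 2 first.
  - by [].
  - case=> x y; rewrite /mkset subr0 unit_diskE => h.
    have h2 : normc (x +i* y)%C ^+ 2 <= 3^-1 ^+ 2.
      by apply: lerXn2r => //; rewrite nnegrE; [exact: sqrtr_ge0|].
    by rewrite normc_sqr in h2; apply: le_lt_trans h2 _; lra.
  have uM : circle_mean (fun z => (H z)%:E) 0%C 3^-1 = M%:E.
    apply: circle_meanE => // t.
    rewrite -[0%C]/(0 +i* 0)%C circleE /H /capped_tan -/(third_circle_tan t).
    by rewrite min_l// third_circle_tan_le2.
  rewrite -uM /circle_mean lee_pmul2l// ?lte_fin ?invr_gt0 ?mulr_gt0//.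
  apply: nonneg_le_integral => t _; first by rewrite lee_fin ltW// capped_tan_gt0.
  by apply: le_trans (uL _ (third_in t)); exact: HL.
(* At the point [z] with tangent [t], the value [M] at [0] forces [R_beta H] to be at least [M t^q],
   while the superharmonic function [x^q + 20 x] bounds it by [t^q + 20 t]. Then divide by [t^q]. *)
have key t : 0 < t < 1 -> M - 1 <= 20 * t `^ (1 - q).
  move=> t01; have /andP[t0 t1] := t01.
  have [z [Dz zt hz]] := exists_tan_half_angle t01.
  have x0 := half_angle_gt0 Dz; have x1 := half_angle_lt_pihalf Dz.
  have xt : half_angle z <= t by rewrite -zt; apply: tan_ge; rewrite x0.
  have h1 : ((M * t `^ q)%:E <= log_lipschitz_reduced beta H z)%E.
    apply: le_ereal_inf_tmp => _ [u [su [u0 ul] uH] <-]; rewrite lee_fin.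
    have Mu : M <= u 0%C.
      rewrite -lee_fin; apply: le_trans MH _; rewrite eqz; last exact: unit_disk0.
      by apply: ereal_inf_lbound; exists u.
    have := ul _ _ unit_disk0 Dz; rewrite hz ler_norml => /andP[_ h].
    have uz := u0 _ Dz; have u00 := u0 _ unit_disk0.
    apply: (@le_trans _ _ (u 0%C * t `^ q)); first by rewrite ler_pM2r ?powR_gt0.
    rewrite -ler_ln ?posrE ?mulr_gt0 ?powR_gt0// lnM ?posrE ?powR_gt0// ln_powR /q.
    lra.
  have h2 : (reduced (log_lipschitz_majorant beta H) z <=
      (half_angle z `^ q + 20 * half_angle z)%:E)%E.
    apply: ereal_inf_lbound.
    exists (fun z => (half_angle z `^ q + 20 * half_angle z)%:E) => //; split.
      exact: superharmonic_powR.
    move=> w Dw; rewrite bE; apply: le_trans (log_lipschitz_majorant_capped_tan q0 Dw) _.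
    by rewrite lee_fin min_tan_powR_le// half_angle_gt0// half_angle_lt_pihalf.
  rewrite eqz// in h2; have := le_trans h1 h2; rewrite lee_fin => h3.
  have xq : half_angle z `^ q <= t `^ q.
    by apply: (ge0_ler_powR (ltW q0)); rewrite ?nnegrE ?(ltW t0) ?(ltW x0).
  have tq : t `^ q * t `^ (1 - q) = t.
    rewrite -powRD; first by rewrite addrC subrK powRr1// ltW.
    by rewrite (gt_eqF t0) implybT.
  have tq0 : 0 < t `^ q by exact: powR_gt0.
  rewrite -(ler_pM2l tq0).
  have -> : t `^ q * (20 * t `^ (1 - q)) = 20 * t by rewrite mulrCA tq.
  lra.
(* [s] plays the role of [t^(1 - q)]: the second bound gives [20 s <= (M - 1) / 2], against [key],
   and the first one ensures [t < 1]. *)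
pose s := Num.min 2^-1 ((M - 1) / 40).
have s0 : 0 < s by rewrite lt_min invr_gt0 ltr0n/= divr_gt0//; lra.
have sM : s <= (M - 1) / 40 by rewrite ge_min lexx orbT.
have s1 : s <= 2^-1 by rewrite ge_min lexx.
have q1' : 0 < 1 - q by lra.
pose t := s `^ (1 - q)^-1.
have t0 : 0 < t by apply: powR_gt0.
have tE : t `^ (1 - q) = s by rewrite /t -powRrM mulVf ?gt_eqF// powRr1// ltW.
have t1 : t < 1.
  rewrite ltNge; apply/negP => h.
  have := ler_powR h (ltW q1'); rewrite powRr0 tE; lra.
have := key t; rewrite t0 t1 tE => /(_ isT); lra.
Qed.

End reduced_functions.

Unset Implicit Arguments.

Theorem proposition2 (R : realType) (gamma beta : R)
    (hgamma : 0 < gamma) (hgamma_beta : gamma <= beta) (hbeta : beta < 2) :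
  exists H : R[i] -> R,
    [/\ forall z, unit_disk R z -> 0 < H z,
        [bounded H z | z in unit_disk R] &
        exists2 z, unit_disk R z &
          reduced (log_lipschitz_majorant gamma H) z
            <> log_lipschitz_reduced beta H z].
Proof.
have beta0 : 0 < beta by exact: lt_le_trans hgamma_beta.
have q01 : 0 < beta / 2 < 1 by apply/andP; split; lra.
have /andP[q0 q1] := q01.
have bdd (H : R[i] -> R) : (forall z, unit_disk R z -> 0 < H z) ->
    (forall z, unit_disk R z -> H z <= 2) -> [bounded H z | z in unit_disk R].
  move=> H0 H2; exists 2; split; first exact: num_real.
  by move=> M M2 z Dz /=; rewrite gtr0_norm ?H0// (le_trans (H2 _ Dz))// ltW.
move: hgamma_beta; rewrite le_eqVlt => /orP[/eqP gb|gb].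
  exists (capped_tan (beta / 2)); split.
  - exact: capped_tan_gt0.
  - apply: bdd => z Dz; first exact: capped_tan_gt0.
    apply: (@le_trans _ _ (2 `^ (beta / 2))).
      apply: (ge0_ler_powR (ltW q0)); rewrite ?nnegrE//.
        by rewrite le_min (ltW (tan_half_angle_gt0 Dz))/=.
      by rewrite ge_min lexx orbT.
    by rewrite -[leRHS]powRr1// ler_powR// ?ler1n// ltW.
  - by rewrite gb; exact: reduced_neq_diagonal.
exists (fun z => half_angle z `^ (beta / 2)); split.
- by move=> z Dz; apply: powR_gt0; exact: half_angle_gt0.
- apply: bdd => z Dz; first by apply: powR_gt0; exact: half_angle_gt0.
  exact: half_angle_powR_le2.
- exact: reduced_neq_of_lt.
Qed.
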